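(* Let $X$ be a super-reflexive Banach space. There exist a constant $C_r>0$ and $w\in(0,1/2]$, depending only on $X$, such that the sequence $r_k(X)=C_r k^{-w}$ has the following property. Let $k\ge 1$ be a natural number, let $\alpha\in(0,1]$ and $\beta=1-(1-\alpha)^{1/k}$, and let $\mathcal{F}_1,\dots,\mathcal{F}_k$ be finite, non-empty families of convex sets in $X$. If for at least an $\alpha$ fraction of the rainbow $k$-tuples $K_1\in\mathcal{F}_1,\dots,K_k\in\mathcal{F}_k$ the set $\bigcap_{i=1}^k K_i$ contains a point of the unit ball $\mathbf{B}$, then there exist $x\in X$ and $i\in\{1,\dots,k\}$ such that at least $\beta|\mathcal{F}_i|$ elements of $\mathcal{F}_i$ intersect the ball $r_k(X)\mathbf{B}+x$.
   Context: Banach spaces are real. $\mathbf{B}=\{x\in X:\|x\|\le 1\}$ is the unit ball centered at the origin. $|\mathcal{F}|$ is the size of a family $\mathcal{F}$. A rainbow $k$-tuple is a choice of one set from each of $\mathcal{F}_1,\dots,\mathcal{F}_k$; there are $\prod_{i=1}^k|\mathcal{F}_i|$ of them. A Banach space $X$ is super-reflexive if every Banach space finitely representable in $X$ is reflexive; equivalently, $X$ admits an equivalent uniformly convex norm. *)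

(* Defs.v *)
From HB Require Import structures.
From mathcomp Require Import all_boot all_order all_algebra.
From mathcomp Require Import all_classical all_reals all_analysis.

Set Implicit Arguments.
Unset Strict Implicit.
Unset Printing Implicit Defensive.

Import Order.TTheory GRing.Theory Num.Theory.
Import numFieldNormedType.Exports.

Local Open Scope classical_set_scope.
Local Open Scope ring_scope.

Definition unit_ball (R : realType) (X : normedModType R) : set X :=
  [set x | `|x| <= 1].
Arguments unit_ball {R} X.

(* The translated dilate [r B + x] of the unit ball [B]. *)
Definition scaled_ball (R : realType) (X : normedModType R) (r : R) (x : X) :
    set X :=
  [set r *: b + x | b in unit_ball X].

Definition dual (R : realType) (Y : normedModType R) : set (Y -> R^o) :=
  [set f | linear f /\ continuous f].
Arguments dual {R} Y.

(* Meaningful on [dual Y], where the set of values is bounded. *)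
Definition dual_norm (R : realType) (Y : normedModType R) (f : Y -> R^o) : R :=
  sup [set `|f y| | y in unit_ball Y].

(* Elements of the second dual are represented by functionals on the whole
   space of maps [Y -> R^o] of which only the restriction to [dual Y] matters. *)
Definition bidual (R : realType) (Y : normedModType R) :
    set ((Y -> R^o) -> R) :=
  [set Phi |
    (forall (a : R) f g, dual Y f -> dual Y g ->
       Phi (a *: f + g) = a * Phi f + Phi g) /\
    (exists C : R, forall f, dual Y f -> `|Phi f| <= C * dual_norm f)].
Arguments bidual {R} Y.

(* The canonical embedding of [Y] into its second dual is onto. *)
Definition reflexive_space (R : realType) (Y : normedModType R) : Prop :=
  forall Phi, bidual Y Phi ->
    exists y : Y, forall f, dual Y f -> Phi f = f y.

Definition lin_span (R : realType) (Y : normedModType R) (n : nat)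
    (v : 'I_n -> Y) : set Y :=
  [set y | exists c : 'I_n -> R, y = \sum_(i < n) c i *: v i].

(* [T] restricts to a linear isomorphism from the subspace [E] onto its image,
   with [||T|| <= b] and [||T^-1|| <= a^-1] for some [0 < a] and [b <= D * a],
   i.e. [||T|| * ||T^-1|| <= D]. The values of [T] outside [E] are irrelevant. *)
Definition embeds_with_distortion (R : realType) (Y X : normedModType R)
    (E : set Y) (D : R) (T : Y -> X) : Prop :=
  (forall (c : R) u v, E u -> E v -> T (c *: u + v) = c *: T u + T v) /\
  (exists a b : R, [/\ 0 < a, b <= D * a &
     forall u, E u -> a * `|u| <= `|T u| <= b * `|u|]).

Definition finitely_representable (R : realType) (Y X : normedModType R) :
    Prop :=
  forall (n : nat) (v : 'I_n -> Y) (eps : R), 0 < eps ->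
    exists T : Y -> X, embeds_with_distortion (lin_span v) (1 + eps) T.

Definition super_reflexive (R : realType) (X : completeNormedModType R) :
    Prop :=
  forall Y : completeNormedModType R,
    finitely_representable Y X -> reflexive_space Y.

(* A finite family of sets in [X] is a map from a finite index type, so that
   repetitions are allowed, and a rainbow tuple for the families
   [F_i : I_i -> set X] is a choice of an index in each [I_i]. *)
Definition rainbow_tuple (k : nat) (I : 'I_k -> finType) : finType :=
  {dffun forall i : 'I_k, I i}.

Definition num_meeting (R : realType) (X : normedModType R) (J : finType)
    (G : J -> set X) (A : set X) : nat :=
  #|[pred j : J | `[< G j `&` A !=set0 >]]|.

(* Main.v *)
Require Import Defs.
From HB Require Import structures.
From mathcomp Require Import all_boot all_order all_algebra.
From mathcomp Require Import all_classical all_reals all_analysis.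
From mathcomp Require Import ring lra.

Set Implicit Arguments.
Unset Strict Implicit.
Unset Printing Implicit Defensive.

Import Order.TTheory GRing.Theory Num.Theory.
Import numFieldNormedType.Exports.

Local Open Scope classical_set_scope.
Local Open Scope ring_scope.

(** Why the theorem holds.

    The proof is a pursuit game.  A point hides in a set [A]; in each round the
    seeker plays a point [x] and is told a convex set that contains the hidden
    point and all of whose points are at distance more than [r] from [x].
    [wins r n A] says that the seeker can make the answers contradictory within
    [n] rounds.

    - If the seeker wins in [k] rounds on the unit ball, the colourful statement
      with radius [r] follows by counting ([wins_fractional_helly]).  Suppose
      that no ball of radius [r] meets a [beta] fraction of any family.  Then at
      each position of the game more than a fraction [1 - beta] of the family
      [F_i] are legal answers in round [i], so that more than
      [(1 - beta)^k = 1 - alpha] of the rainbow tuples are complete plays, and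
      the intersection of a complete play misses the unit ball.
    - The game is self-similar: the intersection of the answers that refute a
      ball of radius [r] is one convex set missing that ball, hence one legal
      answer in a game of radius [r].  So winning [(r, m)] and [(s, n)] gives
      winning [(r s, m n)] ([wins_mul]), and a single win at radius [1/2]
      yields the rate [2 k^(-w)] by iteration ([wins_rate]).
    - If the seeker never wins at radius [1/2], James's criterion for the failure
      of super-reflexivity appears.  The seeker plays a finite net of all
      bounded combinations of the points [x_0, ..., x_(m-1)] selected so far, and
      any point of the surviving convex set can serve as [x_m].  This gives
      arbitrarily long finite sequences in the unit ball whose convex hull of
      later terms stays [1/4] away from the bounded combinations of earlier terms
      ([james_sequence]).
    - These sequences live in [X] but vary with their length.  The ultralimit of
      the corresponding seminorms on polynomials (['X^i] standing for the
      [i]-th term) is a seminorm whose completion [Y] is finitely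
      representable in [X] ([near_isometry_finitely_representable]) and carries
      one infinite sequence with the same separation.  If [Y] were reflexive, the
      ultralimit of that sequence in the second dual would be a point [y] of [Y],
      lying in the closed convex hull of every tail (Hahn-Banach) and
      approximable by finite combinations, which the separation forbids
      ([super_reflexive_wins]). *)

(** * The pursuit game *)

Lemma convex_setE (R : realType) (V : lmodType R) (A : set V) :
  @convex_set R V A <->
  forall x y (t : R), 0 <= t -> t <= 1 -> A x -> A y ->
    A (t *: x + (1 - t) *: y).
Proof.
split=> [cA x y t t0 t1 Ax Ay|cA x y t /set_mem Ax /set_mem Ay]; last first.
  by apply/mem_set; exact: cA.
have t01 : (0 <= t <= 1)%R by rewrite t0 t1.
have := cA x y (Itv01 t0 t1) (mem_set Ax) (mem_set Ay).
by move/set_mem.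
Qed.

Section Game.
Context {R : realType} {X : normedModType R}.
Implicit Types (A K D : set X) (x y z : X) (r s : R) (n : nat).

(** The remaining set [A] collects the positions of the hidden point that are
    compatible with the answers so far, so that the seeker has won once it is
    empty. *)
Fixpoint wins r n A : Prop :=
  if n is m.+1 then
    exists x, forall K, @convex_set R X K ->
      (forall y, K y -> r < `|y - x|) -> wins r m (A `&` K)
  else A = set0.

Lemma convex_setI A K :
  @convex_set R X A -> @convex_set R X K -> @convex_set R X (A `&` K).
Proof.
move=> /convex_setE cA /convex_setE cK; apply/convex_setE => x y t t0 t1.
by move=> [Ax Kx] [Ay Ky]; split; [exact: cA|exact: cK].
Qed.

Lemma convex_setT : @convex_set R X [set: X].
Proof. by apply/convex_setE. Qed.

Lemma convex_unit_ball : @convex_set R X (unit_ball X).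
Proof.
apply/convex_setE => x y t t0 t1; rewrite /unit_ball /= => hx hy.
rewrite (le_trans (ler_normD _ _))// !normrZ ger0_norm// ger0_norm ?subr_ge0//.
have : t * `|x| <= t by rewrite ler_piMr.
have : (1 - t) * `|y| <= 1 - t by rewrite ler_piMr ?subr_ge0.
lra.
Qed.

Lemma wins_subset r n A A' : A' `<=` A -> wins r n A -> wins r n A'.
Proof.
elim: n A A' => [|n IH] A A' AA' /=; first by move=> A0; rewrite -subset0 -A0.
move=> [x hx]; exists x => K cK Kx; apply: IH (hx K cK Kx).
exact: setSI.
Qed.

Lemma wins_le r m n A : (m <= n)%N -> wins r m A -> wins r n A.
Proof.
elim: n m A => [|n IH] [|m] A //= mn.
- move=> A0; exists 0 => K _ _; apply: (IH 0%N) => //=.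
  by rewrite A0 set0I.
- by move=> [x hx]; exists x => K cK Kx; apply: (IH m) => //; exact: hx.
Qed.

Lemma wins_radius r s n A : r <= s -> wins r n A -> wins s n A.
Proof.
move=> rs; elim: n A => [//|n IH] A /= [x hx]; exists x => K cK Kx.
by apply: IH; apply: hx => // y /Kx; exact: le_lt_trans.
Qed.

(** The game is invariant under homotheties. *)
Lemma wins_affine r n A (u : X) s : 0 < s -> wins r n A ->
  wins (s * r) n [set y | A (s^-1 *: (y - u))].
Proof.
move=> s0; elim: n A => [|n IH] A /=.
  by move=> ->; rewrite -subset0.
move=> [x hx]; exists (u + s *: x) => K cK Kx.
have sK y : u + s *: (s^-1 *: (y - u)) = y.
  by rewrite scalerA divff ?gt_eqF// scale1r addrC subrK.
pose K' := [set z | K (u + s *: z)].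
have cK' : @convex_set R X K'.
  apply/convex_setE => y z t t0 t1 Ky Kz.
  move/convex_setE: cK => /(_ _ _ t t0 t1 Ky Kz).
  rewrite /K' /= !scalerDr !scalerA [s * t]mulrC [s * (1 - t)]mulrC.
  rewrite addrACA -scalerDl.
  by rewrite addrC [t + _]addrC subrK scale1r addrC.
have K'x z : K' z -> r < `|z - x|.
  move=> /Kx; rewrite opprD addrACA subrr add0r -scalerBr normrZ gtr0_norm//.
  by rewrite ltr_pM2l.
apply: wins_subset (IH _ (hx _ cK' K'x)).
by move=> y [Ay Ky] /=; split => //; rewrite /K' /= sK.
Qed.

(** Winning first on an auxiliary set [D] is a way of producing a single convex
    answer disjoint from [D]: the intersection [K] of the answers given
    meanwhile.  The play on [A] then resumes with [K] recorded. *)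
Lemma wins_cat r m n A D : wins r m D ->
  (forall K, @convex_set R X K -> D `&` K = set0 -> wins r n (A `&` K)) ->
  wins r (m + n) A.
Proof.
elim: m A D => [|m IH] A D /=.
  by move=> -> h; rewrite -[A]setIT; apply: h; rewrite ?set0I//; exact: convex_setT.
move=> [x hx] h; exists x => K cK Kx.
apply: (IH _ (D `&` K)); first exact: hx.
move=> L cL; rewrite -!setIA => DKL; apply: h => //.
exact: convex_setI.
Qed.

(** Each round of the game of radius [r] at a point [x] is simulated by [n]
    rounds of radius [r * s] that refute the ball of radius [r] around [x]. *)
Lemma wins_mul r s m n A : 0 < r ->
  wins r m A -> wins s n (unit_ball X) -> wins (r * s) (m * n) A.
Proof.
move=> r0 + hB; elim: m A => [//|m IH] A [x hx].
rewrite mulSn; apply: wins_cat (wins_affine x r0 hB) _ => K cK DK.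
apply: IH; apply: hx => // y Ky.
rewrite ltNge; apply/negP => yx.
suff : set0 y by [].
rewrite -DK; split => //=; rewrite /unit_ball /= normrZ gtr0_norm ?invr_gt0//.
by rewrite mulrC ler_pdivrMr// mul1r.
Qed.

Lemma wins_expn s n m : 0 < s ->
  wins s n (unit_ball X) -> wins (s ^+ m) (n ^ m) (unit_ball X).
Proof.
move=> s0 h; elim: m => [|m IH]; last first.
  by rewrite exprSr expnSr; apply: wins_mul => //; rewrite exprn_gt0.
rewrite expr0 expn0 /=; exists 0 => K cK Kx; rewrite -subset0 => y [].
by rewrite /unit_ball /= => y1 /Kx; rewrite subr0 ltNge y1.
Qed.

Lemma wins_set0 r n : wins r n set0.
Proof. exact: (@wins_le r 0). Qed.

(** If the hider survives long enough, some convex set of surviving positions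
    avoids the balls around all points of a list played one after the other. *)
Lemma survive_points r n (s : seq X) A : ~ wins r (size s + n) A ->
  exists K, [/\ @convex_set R X K,
    (forall p y, p \in s -> K y -> r < `|y - p|) & ~ wins r n (A `&` K)].
Proof.
elim: s A => [|p s IH] A /=.
  by move=> h; exists setT; split; [exact: convex_setT| |rewrite setIT].
move=> /forallNP /(_ p) /existsNP[K] /not_implyP[cK] /not_implyP[Kp].
move=> /IH[L [cL Ls h]]; exists (K `&` L); split.
- exact: convex_setI.
- by move=> q y; rewrite inE => /orP[/eqP ->|qs] [Ky Ly]; [exact: Kp|exact: Ls].
- by rewrite setIA.
Qed.

End Game.

(** * From a winning strategy to the colourful counting *)

Section Counting.
Context {R : realType} {X : normedModType R} (k : nat).
Context (I : 'I_k -> finType) (F : forall i : 'I_k, I i -> set X).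
Arguments F : clear implicits.
Context (r : R) (m : 'I_k -> nat).
Hypothesis cF : forall i (j : I i), @convex_set R X (F i j).
Hypothesis mF : forall i x,
  (m i <= #|[pred j | `[< forall y, F i j y -> (r < `|y - x|)%R >]]|)%N.

(** The rounds of the game are indexed by the list [l].  The coordinates of the
    tuple outside [l] are frozen to those of [t0], which lets the induction run
    over one fixed type of tuples although the index types differ. *)
Lemma wins_count (l : seq 'I_k) (A : set X) (t0 : rainbow_tuple I) :
  uniq l -> wins r (size l) A ->
  (\prod_(i <- l) m i <= #|[pred t : rainbow_tuple I |
     `[< (forall i, i \notin l -> t i = t0 i) /\
         forall y, A y -> (forall i, i \in l -> F i (t i) y) -> False >]]|)%N.
Proof.
elim: l A t0 => [|i l IH] A t0 /=.
  move=> _ A0; rewrite big_nil lt0n; apply/negP => /eqP /card0_eq /(_ t0).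
  by rewrite inE => /asboolP; apply; split => // y; rewrite A0.
move=> /andP[il ul] [x hx].
rewrite big_cons -sum1_card (partition_big (fun t : rainbow_tuple I => t i) predT)//=.
pose J := [pred j | `[< forall y, F i j y -> r < `|y - x| >]].
(* Only the answers that are legal at the seeker's point [x] are counted. *)
apply: (@leq_trans (\sum_(j in J) \prod_(a <- l) m a)).
  by rewrite sum_nat_const leq_mul2r mF orbT.
rewrite [leqRHS](bigID (mem J))/= -[leqLHS]addn0 leq_add//.
apply: leq_sum => j Jj.
pose t1 : rainbow_tuple I := [ffun a => @eqtype.dfwith _ I (fun b => t0 b) i j a].
have Kj : forall y, F i j y -> r < `|y - x| by apply/asboolP.
apply: leq_trans (IH (A `&` F i j) t1 ul (hx _ (@cF i j) Kj)) _.
rewrite -sum1_card; apply: eq_leq; apply: eq_bigl => t.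
rewrite !inE; apply/asboolP/andP => [[tt1 tA]|[/asboolP[tt0 tA] /eqP tj]].
  have tj : t i = j by rewrite tt1// ffunE dfwith_in.
  split; last by rewrite tj.
  apply/asboolP; split=> [a|y Ay Fy].
    rewrite inE negb_or => /andP[ai al].
    by rewrite tt1// ffunE dfwith_out// eq_sym.
  apply: (tA y); first by split => //; rewrite -tj; apply: Fy; rewrite mem_head.
  by move=> a al; apply: Fy; rewrite inE al orbT.
split=> [a al|y [Ay Fy] Fl].
  rewrite ffunE; have [ia|ai] := eqVneq i a.
    by case: _ / ia; rewrite dfwith_in.
  by rewrite dfwith_out// tt0// inE negb_or al eq_sym ai.
apply: (tA y) => // a; rewrite inE => /orP[/eqP ->|]; first by rewrite tj.
exact: Fl.
Qed.

End Counting.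

Lemma scaled_ballE (R : realType) (X : normedModType R) (r : R) (x : X) :
  0 < r -> scaled_ball r x = [set y | `|y - x| <= r].
Proof.
move=> r0; apply/seteqP; split=> [y [b b1 <-]|y /= yx].
  by rewrite /= addrK normrZ gtr0_norm// ler_piMr// ltW.
exists (r^-1 *: (y - x)).
  by rewrite /unit_ball /= normrZ gtr0_norm ?invr_gt0// mulrC ler_pdivrMr// mul1r.
by rewrite scalerA divff ?gt_eqF// scale1r subrK.
Qed.

(** With [b = 1 - beta], a failure of the conclusion leaves more than
    [b * #|I i|] sets of the family [i] away from any given ball.  Replacing this
    real bound by the least larger integer [m i] keeps the inequality
    [b * #|I i| < m i] strict and makes [m i] positive even when [b = 0]. *)
Lemma wins_fractional_helly (R : realType) (X : normedModType R) (k : nat)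
    (alpha r : R) (I : 'I_k -> finType) (F : forall i : 'I_k, I i -> set X) :
  (0 < k)%N -> 0 < r -> wins r k (unit_ball X) ->
  0 < alpha -> alpha <= 1 ->
  (forall i : 'I_k, (0 < #|I i|)%N) ->
  (forall (i : 'I_k) (j : I i), @convex_set R X (F i j)) ->
  alpha * (\prod_(i < k) #|I i|)%N%:R <=
    (num_meeting
      (fun t : rainbow_tuple I => \bigcap_(i in [set: 'I_k]) F i (t i))
      (unit_ball X))%:R ->
  exists (x : X) (i : 'I_k),
    (1 - (1 - alpha) `^ (k%:R^-1)) * #|I i|%:R <=
      (num_meeting (F i) (scaled_ball r x))%:R.
Proof.
move=> k0 r0 win a0 a1 I0 cF meet; apply: contrapT => /forallNP H.
set b := (1 - alpha) `^ (k%:R^-1).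
have b0 : 0 <= b by exact: powR_ge0.
pose m i := (Num.truncn (b * #|I i|%:R)).+1.
have bm i : b * #|I i|%:R < (m i)%:R by rewrite truncnS_gt.
have mF i x :
    (m i <= #|[pred j | `[< forall y, F i j y -> (r < `|y - x|)%R >]]|)%N.
  have /forallNP /(_ i) /negP := H x; rewrite -ltNge => Hi.
  have := cardC [pred j | `[< F i j `&` scaled_ball r x !=set0 >]].
  rewrite -/(num_meeting (F i) (scaled_ball r x)) => /(congr1 (fun n => n%:R : R)).
  rewrite natrD; set c := #|predC _| => hc.
  have : b * #|I i|%:R < c%:R by move: Hi hc; rewrite -/b; lra.
  rewrite -truncn_lt_nat ?mulr_ge0// => /leq_trans; apply.
  apply: subset_leq_card; apply/fintype.subsetP => j; rewrite !inE => /asboolP Hj.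
  move=> y Fy; rewrite ltNge; apply/negP => yx.
  by apply: Hj; exists y; split=> //; rewrite scaled_ballE.
pose t0 : rainbow_tuple I := [ffun i => enum_val (Ordinal (I0 i))].
have := @wins_count R X k I F r m cF mF (enum 'I_k) _ t0 (enum_uniq _).
rewrite (_ : size (enum 'I_k) = k); last by rewrite -cardE card_ord.
move=> /(_ _ win); rewrite big_enum /=; set P := #|_| => leP.
have := cardC [pred t : rainbow_tuple I |
  `[< (\bigcap_(i in [set: 'I_k]) F i (t i)) `&` unit_ball X !=set0 >]].
rewrite -/(num_meeting _ _) => /(congr1 (fun n => n%:R : R)).
rewrite natrD; set c := #|predC _| => hc.
have {}leP : (\prod_(i < k) m i <= c)%N.
  apply: leq_trans leP _; apply: subset_leq_card; apply/fintype.subsetP => t.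
  rewrite !inE => -[_ Ht]; apply/negP => /asboolP[y [Fy By]].
  by apply: (Ht y) => // i _; apply: Fy.
have lt : (1 - alpha) * (\prod_(i < k) #|I i|)%N%:R < (\prod_(i < k) m i)%N%:R.
  have -> : 1 - alpha = b ^+ k.
    rewrite /b -powR_mulrn ?powR_ge0// -powRrM mulVf ?pnatr_eq0 -?lt0n// powRr1//.
    by rewrite subr_ge0.
  rewrite !natr_prod -[X in b ^+ X]card_ord -prodr_const -big_split /=.
  apply: ltr_prod => [|i _].
    by apply/hasP; exists (Ordinal k0); rewrite ?mem_index_enum.
  by rewrite mulr_ge0//= bm.
have cP : #|rainbow_tuple I| = (\prod_(i < k) #|I i|)%N.
  by rewrite card_dep_ffun foldrE big_image.
have : (\prod_(i < k) m i)%N%:R <= c%:R :> R by rewrite ler_nat.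
move: meet lt hc; rewrite cP.
lra.
Qed.

(** * Separated sequences when the seeker never wins *)

Lemma box_net (R : realType) (l : nat) (M e : R) : 0 < e ->
  exists s : seq {ffun 'I_l -> R}, forall a : 'I_l -> R,
    (forall i, `|a i| <= M) ->
    exists2 g, g \in s & forall i, `|a i - g i| <= e.
Proof.
move=> e0; pose K := Num.truncn (2 * M / e).
exists [seq [ffun i => - M + (f i : nat)%:R * e] | f : {ffun 'I_l -> 'I_K.+1}].
move=> a aM; pose n i := Num.truncn ((a i + M) / e).
have aM0 i : 0 <= (a i + M) / e.
  by apply: divr_ge0; [have := aM i; rewrite ler_norml => /andP[]; lra|exact: ltW].
have nK i : (n i < K.+1)%N.
  rewrite ltnS; apply: le_truncn; rewrite ler_pM2r ?invr_gt0//.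
  by have := aM i; rewrite ler_norml => /andP[]; lra.
exists [ffun i => - M + ([ffun i => Ordinal (nK i)] i : 'I_K.+1)%:R * e].
  by apply/fintype.imageP; exists [ffun i => Ordinal (nK i)].
move=> i; rewrite !ffunE /=.
have /andP[n1 n2] := truncn_itv (aM0 i).
rewrite -/(n i) in n1 n2; move: n1 n2.
rewrite ler_pdivlMr// ltr_pdivrMr// -natr1 mulrDl mul1r ler_norml => n1 n2.
by apply/andP; split; lra.
Qed.

Section James.
Context {R : realType} {X : normedModType R}.

(** [N] may depend only on the number [l] of points already chosen, on the
    number [n] of points still to choose and on [M], not on the points: the net
    of the coefficient box has a size depending on [l] and [M] only, and playing
    it costs that many rounds.  The surviving set then avoids the combinations of
    the net by more than [1/2], hence all combinations by [1/4]. *)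
Lemma james_step (n l : nat) (M : R) : exists N : nat,
  forall (A : set X) (x : nat -> X), @convex_set R X A ->
    A `<=` unit_ball X -> (forall i, (i < l)%N -> `|x i| <= 1) ->
    ~ wins 2^-1 N A ->
  exists y : nat -> X, (forall i, (i < l)%N -> y i = x i) /\
    forall m, (l <= m < l + n)%N -> exists D : set X,
      [/\ @convex_set R X D, D `<=` A,
        forall i, (m <= i < l + n)%N -> D (y i) &
        forall (a : nat -> R) z, (forall i, `|a i| <= M) -> D z ->
          4^-1 <= `|z - \sum_(i < m) a i *: y i|].
Proof.
elim: n l => [|n IH] l.
  exists 0%N => A x _ _ _ _; exists x; split => // m.
  by rewrite addn0 => /andP[/leq_ltn_trans h /h]; rewrite ltnn.
have [N hN] := IH l.+1.
(* A coefficient error of at most [1 / (4 (l + 1))] moves a combination of [l]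
   points of the unit ball by at most [1/4]. *)
have e0 : 0 < (4 * l.+1%:R)^-1 :> R by rewrite invr_gt0 mulr_gt0.
have [s hs] := box_net l M e0.
exists (size s + N)%N => A x cA A1 x1.
pose pts := [seq \sum_(i < l) g i *: x i | g : {ffun 'I_l -> R} <- s].
rewrite -(size_map (fun g : {ffun 'I_l -> R} => \sum_(i < l) g i *: x i)) -/pts.
move=> /survive_points[K [cK Kpts survA']].
have [p [Ap Kp]] : (A `&` K) !=set0.
  apply/set0P; apply: contra_notN survA' => /eqP ->; exact: wins_set0.
pose x' i := if i == l then p else x i.
have x'1 i : (i < l.+1)%N -> `|x' i| <= 1.
  rewrite ltnS leq_eqVlt /x'; case: eqP => [_ _|_ /= /x1//].
  exact: A1.
have := hN (A `&` K) x' (convex_setI cA cK) (fun y h => A1 y (proj1 h)) x'1 survA'.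
move=> [y [yx' hy]]; exists y; split.
  by move=> i il; rewrite yx' ?(leqW il)// /x' ltn_eqF.
move=> m /andP[]; rewrite leq_eqVlt => /orP[/eqP <- _|lm mn]; last first.
  have [|D [cD DA Dy Dz]] := hy m; first by rewrite lm addSnnS.
  exists D; split => //; last by move=> i; rewrite -addSnnS; exact: Dy.
  by move=> z /DA[].
exists (A `&` K); split.
- exact: convex_setI.
- by move=> z [].
- move=> i /andP[]; rewrite leq_eqVlt => /orP[/eqP <- _|li iln].
    by rewrite yx'// /x' eqxx.
  have [|D [cD DA Dy _]] := hy i; first by rewrite li addSnnS.
  by apply: DA; apply: Dy; rewrite leqnn addSnnS.
move=> a z aM [_ Kz].
have -> : \sum_(i < l) a i *: y i = \sum_(i < l) a i *: x i.
  apply: eq_bigr => i _; congr (_ *: _).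
  by rewrite yx' ?(leqW (ltn_ord i))// /x' ltn_eqF.
have [g gs ga] := hs (fun i => a i) (fun i => aM i).
have := Kpts (\sum_(i < l) g i *: x i) z (map_f _ gs) Kz.
have : `|\sum_(i < l) a i *: x i - \sum_(i < l) g i *: x i| <= 4^-1.
  rewrite -sumrB (le_trans (ler_norm_sum _ _ _))//.
  apply: (@le_trans _ _ (\sum_(i < l) (4 * l.+1%:R)^-1)).
    apply: ler_sum => i _; rewrite -scalerBl normrZ -[leRHS]mulr1.
    by apply: ler_pM => //; exact: x1.
  rewrite sumr_const card_ord -[leLHS]mulr_natr invfM -mulrA ler_piMr//.
  by rewrite mulrC ler_pdivrMr// mul1r ler_nat.
set u := \sum_(i < l) a i *: _; set v := \sum_(i < l) g i *: _.
move=> uv zv; have : `|z - v| <= `|z - u| + `|u - v|.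
  by rewrite -[z - v](subrKA u) ler_normD.
by move: uv zv; rewrite (_ : 4^-1 = 2^-1 / 2); [lra|by field].
Qed.

Lemma convex_sum (A : set X) (m n : nat) (c : nat -> R) (x : nat -> X) :
  @convex_set R X A -> (forall i, (m <= i < n)%N -> A (x i)) ->
  (forall i, 0 <= c i) -> \sum_(m <= i < n) c i = 1 ->
  A (\sum_(m <= i < n) c i *: x i).
Proof.
move=> /convex_setE cA xA c0.
have [nm|mn] := leqP n m; first by rewrite big_geq// => /esym/eqP; rewrite oner_eq0.
(* For the induction the total mass [s] of the coefficients is arbitrary. *)
suff h s : 0 < s -> \sum_(m <= i < n) c i = s -> A (s^-1 *: \sum_(m <= i < n) c i *: x i).
  by move=> /h; rewrite invr1 scale1r; apply.
elim: n mn xA s => [//|n IH] mn xA s s0.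
have [nm|{}mn] := leqP n m.
  have -> : n = m by apply/eqP; rewrite eqn_leq nm -ltnS mn.
  rewrite !big_nat1 => ->; rewrite scalerA mulVf ?gt_eqF// scale1r.
  by apply: xA; rewrite leqnn.
rewrite !big_nat_recr ?(ltnW mn)//=; set t := \sum_(m <= i < n) c i => ts.
have xA' i : (m <= i < n)%N -> A (x i).
  by move=> /andP[mi ilt]; apply: xA; rewrite mi ltnW// ltnS.
have An : A (x n) by apply: xA; rewrite (ltnW mn) ltnS leqnn.
have t0 : 0 <= t by apply: sumr_ge0.
have [t00|tn0] := eqVneq t 0.
  rewrite big_nat_cond big1 ?add0r.
    by move: ts; rewrite t00 add0r => ->; rewrite scalerA mulVf ?gt_eqF// scale1r.
  move=> i /andP[/andP[mi ilt] _]; suff -> : c i = 0 by rewrite scale0r.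
  move/eqP: t00; rewrite /t big_nat_cond psumr_eq0// => /allP /(_ i).
  by rewrite mem_index_iota mi ilt => /(_ isT) /= /eqP.
have tp : 0 < t by rewrite lt0r tn0.
have := cA _ _ (t / s) _ _ (IH mn xA' t tp erefl) An.
rewrite scalerDr !scalerA.
have -> : s^-1 * c n = 1 - t / s by rewrite -ts; field; rewrite ts gt_eqF.
rewrite [t / s / t]mulrAC divff// mul1r.
apply; first by rewrite divr_ge0 ?ltW.
by rewrite ler_pdivrMr// mul1r -ts lerDl.
Qed.

End James.
(** The two sides of the separation are merged into one family of coefficients:
    those before [m] are arbitrary within a bound growing with [n], those from
    [m] on form a convex combination. *)
Lemma james_sequence {R : realType} {X : normedModType R} :
  (forall N, ~ @wins R X 2^-1 N (unit_ball X)) ->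
  forall n : nat, exists x : nat -> X,
    (forall i, (i < n)%N -> `|x i| <= 1) /\
    forall (m : nat) (c : nat -> R), (m < n)%N ->
      (forall i, `|c i| <= n%:R) -> (forall i, (m <= i)%N -> 0 <= c i) ->
      \sum_(m <= i < n) c i = 1 ->
      4^-1 <= `|\sum_(i < n) c i *: x i|.
Proof.
move=> H n; have [N hN] := @james_step R X n 0 n%:R.
have [|//|x [_ hx]] := hN _ (fun _ => 0) convex_unit_ball _ _ (H N).
  by [].
exists x; split=> [i ilt|m c mn cn c0 c1].
  have [|D [_ DB Dx _]] := hx i; first by rewrite add0n ilt.
  by apply: DB; apply: Dx; rewrite leqnn.
have [|D [cD _ Dx Dz]] := hx m; first by rewrite add0n mn.
pose c' i := if (m <= i)%N then c i else 0.
have c'm : \sum_(m <= i < n) c' i *: x i = \sum_(m <= i < n) c i *: x i.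
  by apply: eq_big_nat => i /andP[mi _]; rewrite /c' mi.
have Dz0 : D (\sum_(m <= i < n) c i *: x i).
  rewrite -c'm; apply: convex_sum => //.
    by move=> i; rewrite /c'; case: ifP => // /c0.
  by rewrite -c1; apply: eq_big_nat => i /andP[mi _]; rewrite /c' mi.
have cn' i : `|- c i| <= n%:R by rewrite normrN.
have := Dz (fun i => - c i) _ cn' Dz0.
rewrite -(big_mkord xpredT (fun i => - c i *: x i)).
under [X in _ - X]eq_bigr do rewrite scaleNr.
rewrite sumrN opprK addrC -big_cat_nat ?(ltnW mn)//=.
by rewrite big_mkord.
Qed.

(** * Hahn-Banach separation *)

Section HahnBanach.
Context {R : realType} {V : lmodType R}.
Implicit Types (p q : V -> R) (u v : V).

Definition sublinear p :=
  (forall u v, p (u + v) <= p u + p v) /\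
  (forall a u, 0 <= a -> p (a *: u) = a * p u).

Lemma sublinear0 p : sublinear p -> p 0 = 0.
Proof. by move=> [_ /(_ 0 0 (lexx _))]; rewrite scale0r mul0r. Qed.

Lemma sublinearN p u : sublinear p -> - p (- u) <= p u.
Proof.
by move=> hp; rewrite -subr_ge0 opprK -(sublinear0 hp) -(addrN u) hp.1.
Qed.

(** The largest sublinear functional below [p] that is at most [- d] on [- C],
    namely the infimum of [p (v + t c) - t d] over [t >= 0] and [c] in [C]. *)
Lemma sublinear_shift p (C : set V) (d : R) : sublinear p ->
  @convex_set R V C -> C !=set0 -> (forall c, C c -> d <= p c) ->
  exists q, [/\ sublinear q, forall v, q v <= p v &
                forall c, C c -> q (- c) <= - d].
Proof.
move=> sp /convex_setE cC [c0 Cc0] pC; have [pD pZ] := sp.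
pose S v := [set r | exists t c, [/\ 0 <= t, C c & r = p (v + t *: c) - t * d]].
have SE v t c : 0 <= t -> C c -> S v (p (v + t *: c) - t * d).
  by move=> t0 Cc; exists t, c.
have Slb v : lbound (S v) (- p (- v)).
  move=> _ [t [c [t0 Cc ->]]].
  have : p (t *: c) <= p (v + t *: c) + p (- v).
    by rewrite -{1}[t *: c](addKr v) addrC pD.
  by rewrite pZ//; have := ler_wpM2l t0 (pC _ Cc); lra.
have Shi v : has_inf (S v).
  by split; [exists (p (v + 0 *: c0) - 0 * d); exact: SE|exists (- p (- v))].
pose q v := inf (S v).
have qle v t c : 0 <= t -> C c -> q v <= p (v + t *: c) - t * d.
  by move=> t0 Cc; apply: ge_inf; [exact: (Shi v).2|exact: SE].
have qge v x : (forall t c, 0 <= t -> C c -> x <= p (v + t *: c) - t * d) ->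
    x <= q v.
  by move=> h; apply: lb_le_inf; [exact: (Shi v).1|move=> _ [t [c [t0 Cc ->]]]; exact: h].
have qp v : q v <= p v.
  by have := qle v 0 c0 (lexx _) Cc0; rewrite scale0r mul0r addr0 subr0.
have qZ a u : 0 < a -> q (a *: u) <= a * q u.
  move=> a0; rewrite mulrC -ler_pdivrMr//; apply: (qge) => t c t0 Cc.
  rewrite ler_pdivrMr//.
  have := qle (a *: u) (a * t) c (mulr_ge0 (ltW a0) t0) Cc.
  by rewrite -scalerA -scalerDr (pZ _ _ (ltW a0)); lra.
exists q; split => //; first split.
- move=> u v; rewrite -lerBlDr; apply: (qge) => t c t0 Cc.
  rewrite lerBlDr -lerBlDl; apply: (qge) => s c' s0 Cc'.
  rewrite lerBlDl.
  have [ts0|ts0] := eqVneq (t + s) 0.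
    have t00 : t = 0 by lra.
    have s00 : s = 0 by lra.
    rewrite t00 s00 !scale0r !mul0r !addr0 !subr0.
    by rewrite (le_trans (qp _)).
  have ts : 0 < t + s by rewrite lt0r ts0 addr_ge0.
  pose c2 := (t / (t + s)) *: c + (1 - t / (t + s)) *: c'.
  have Cc2 : C c2.
    apply: cC => //; first by rewrite divr_ge0// ltW.
    by rewrite ler_pdivrMr// mul1r lerDl.
  have c2E : (t + s) *: c2 = t *: c + s *: c'.
    rewrite /c2 scalerDr !scalerA mulrC divfK//; congr (_ + _ *: _).
    by field.
  have := qle (u + v) (t + s) c2 (ltW ts) Cc2.
  rewrite c2E addrACA; have := pD (u + t *: c) (v + s *: c'); lra.
- move=> a u; rewrite le0r => /orP[/eqP ->|a0].
    rewrite scale0r mul0r; apply/eqP; rewrite eq_le.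
    have := qp 0; rewrite (sublinear0 sp) => ->/=.
    by apply: (qge) => t c t0 Cc; have := Slb 0 _ (SE 0 t c t0 Cc);
       rewrite oppr0 (sublinear0 sp) oppr0.
  apply/eqP; rewrite eq_le qZ//=.
  have := qZ a^-1 (a *: u); rewrite invr_gt0 => /(_ a0).
  by rewrite scalerA mulVf ?gt_eqF// scale1r mulrC ler_pdivlMr// mulrC.
- move=> c Cc; have := qle (- c) 1 c ler01 Cc.
  by rewrite scale1r addNr (sublinear0 sp) mul1r sub0r.
Qed.

(** A minimal sublinear functional below [p] exists by Zorn's lemma, and it is
    linear: shifting it along [C = {u}] cannot decrease it, which forces
    [f (- u) = - f u], and an odd sublinear functional is additive. *)
Lemma hahn_banach p : sublinear p ->
  exists f : V -> R^o, linear f /\ forall v, f v <= p v.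
Proof.
move=> sp.
pose T := {q : V -> R | sublinear q /\ forall v, q v <= p v}.
pose le (s t : T) := `[< forall v, sval t v <= sval s v >].
have [||||[f [sf fp]] fmin] := @Zorn T le.
- by move=> t; apply/asboolP.
- move=> r s t /asboolP rs /asboolP st; apply/asboolP => v.
  exact: le_trans (st v) (rs v).
- move=> [s hs] [t ht] /asboolP /= st /asboolP /= ts.
  apply: eq_exist; apply/funext => v.
  by apply/eqP; rewrite eq_le st ts.
- move=> A tot; have [[t0 At0]|A0] := pselect (A !=set0); last first.
    by exists (exist _ p (conj sp (fun v => lexx _))) => s As; case: A0; exists s.
  pose S v := [set sval s v | s in A].
  have Slb v : lbound (S v) (- p (- v)).
    move=> _ [[s [ss sp']] As <-] /=; apply: le_trans (sublinearN v ss).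
    by rewrite lerN2.
  have Shi v : has_inf (S v).
    by split; [exists (sval t0 v); exists t0|exists (- p (- v))].
  pose q v := inf (S v).
  have qle v s : A s -> q v <= sval s v.
    by move=> As; apply: ge_inf; [exact: (Shi v).2|exists s].
  have qge v x : (forall s, A s -> x <= sval s v) -> x <= q v.
    by move=> h; apply: lb_le_inf; [exact: (Shi v).1|move=> _ [s As <-]; exact: h].
  have hq : sublinear q /\ forall v, q v <= p v.
    split; last by move=> v; apply: le_trans (qle v t0 At0) _; exact: (svalP t0).2.
    split=> [u v|a u a0].
      rewrite -lerBlDr; apply: (qge) => s As.
      rewrite lerBlDr -lerBlDl; apply: (qge) => t At; rewrite lerBlDl.
      have [/asboolP st|/asboolP ts] := tot _ _ As At.
        apply: le_trans (qle _ _ At) _; apply: le_trans ((svalP t).1.1 _ _) _.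
        by rewrite lerD2r.
      apply: le_trans (qle _ _ As) _; apply: le_trans ((svalP s).1.1 _ _) _.
      by rewrite lerD2l.
    apply/eqP; rewrite eq_le; apply/andP; split; last first.
      by apply: (qge) => s As; rewrite (svalP s).1.2// ler_wpM2l// qle.
    move: a0; rewrite le0r => /orP[/eqP ->|a0].
      rewrite scale0r mul0r; apply: le_trans (qle _ _ At0) _.
      by rewrite (sublinear0 (svalP t0).1).
    rewrite mulrC -ler_pdivrMr//; apply: (qge) => s As.
    by rewrite ler_pdivrMr// mulrC -((svalP s).1.2 _ _ (ltW a0)) qle.
  by exists (exist _ q hq) => s As; apply/asboolP => v; exact: qle.
have fN u : f (- u) = - f u.
  have cs : @convex_set R V [set u].
    apply/convex_setE => x y t _ _ -> ->.
    by rewrite /= -scalerDl addrC subrK scale1r.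
  have [|_ ->|q [sq qf /(_ u erefl) qu]] :=
    @sublinear_shift f [set u] (f u) sf cs; [by exists u|by []|].
  have hq : sublinear q /\ forall v, q v <= p v.
    by split=> // v; apply: le_trans (qf v) (fp v).
  have /(congr1 sval) /= qE : exist _ q hq = exist _ f (conj sf fp) :> T.
    by apply: fmin; apply/asboolP.
  apply/eqP; rewrite eq_le; rewrite -{1}qE qu/=.
  by have := sublinearN u sf; rewrite lerNl.
exists f; split=> //.
have fD u v : f (u + v) = f u + f v.
  apply/eqP; rewrite eq_le sf.1/= -[u + v]opprK opprD fN lerNr opprD -!fN.
  exact: sf.1.
move=> a u v; rewrite fD; congr (_ + _).
have [a0|a0] := leP 0 a; first exact: sf.2.
rewrite -[a]opprK scaleNr fN sf.2; last by rewrite oppr_ge0 ltW.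
by rewrite scaleNr.
Qed.

Lemma separation p (C : set V) (d : R) : sublinear p ->
  @convex_set R V C -> C !=set0 -> (forall c, C c -> d <= p c) ->
  exists f : V -> R^o, [/\ linear f, forall v, f v <= p v &
                           forall c, C c -> d <= f c].
Proof.
move=> sp cC C0 pC; have [q [sq qp qC]] := sublinear_shift sp cC C0 pC.
have [f [lf fq]] := hahn_banach sq; exists f; split => //.
  by move=> v; exact: le_trans (fq v) (qp v).
move=> c /qC; have := fq (- c).
have -> : f (- c) = - f c.
  have := lf (-1) c 0; rewrite addr0 scaleN1r => ->.
  have := lf (-1) 0 0; rewrite scaler0 addr0 scaleN1r addNr => ->.
  by rewrite addr0 scaleN1r.
lra.
Qed.

End HahnBanach.

(** * The completion of a seminormed space *)

Section Completion.
Context {R : realType} {V : lmodType R}.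

Definition seminorm (N : V -> R) :=
  (forall u v, N (u + v) <= N u + N v) /\
  (forall a v, N (a *: v) = `|a| * N v).

Lemma seminorm_sublinear N : seminorm N -> sublinear N.
Proof. by move=> [ND NZ]; split=> // a u a0; rewrite NZ ger0_norm. Qed.

Lemma seminormN N v : seminorm N -> N (- v) = N v.
Proof. by move=> [_ NZ]; rewrite -scaleN1r NZ normrN normr1 mul1r. Qed.

(** The unit ball of the dual of the seminormed space [(V, N)]. *)
Definition functional (N : V -> R) :=
  {f : {linear V -> R^o} | forall v, `|f v| <= N v}.

Definition approximable (N : V -> R) : {pred functional N -> R^o} :=
  fun g => `[< forall e : R, 0 < e -> exists v, forall f : functional N,
               `|g f - sval f v| <= e >].

(** The completion is realised inside the bounded functions on the dual unit
    ball, as the uniform closure of the evaluations at the vectors of [V]; this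
    identifies the vectors at distance zero without forming a quotient. *)
Record completion (N : V -> R) (hN : seminorm N) := Completion {
  completion_val :> functional N -> R^o;
  _ : completion_val \in @approximable N }.

(** This makes the sup norm of the evaluation at [v] equal to [N v]. *)
Lemma norming_functional (N : V -> R) (hN : seminorm N) (v : V) :
  exists f : functional N, N v <= sval f v.
Proof.
have sN := seminorm_sublinear hN.
have cv : @convex_set R V [set v].
  apply/convex_setE => x y t _ _ -> ->.
  by rewrite /= -scalerDl addrC subrK scale1r.
have [|_ ->|f [lf fN /(_ v erefl) fv]] :=
  @separation _ _ N [set v] (N v) sN cv; [by exists v|by []|].
pose f' : {linear V -> R^o} :=
  HB.pack f (GRing.isLinear.Build R V R^o *:%R f lf).
have f'N u : `|f' u| <= N u.
  rewrite ler_norml fN andbT lerNl -(linearN f').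
  by rewrite -(seminormN u hN); exact: fN.
by exists (exist _ f' f'N).
Qed.

Section Structure.
Context (N : V -> R) (hN : seminorm N).
Notation Y := (completion hN).
Implicit Types (g h : functional N -> R^o) (f : functional N).

Lemma approximableP g : reflect (forall e : R, 0 < e -> exists v, forall f,
   `|g f - sval f v| <= e) (g \in @approximable N).
Proof. exact: asboolP. Qed.

Lemma approximable_submod_closed : submod_closed (@approximable N).
Proof.
split=> [|a g h /approximableP gN /approximableP hN'].
  apply/approximableP => e e0; exists 0 => f.
  by rewrite linear0 subrr normr0 ltW.
apply/approximableP => e e0.
have a0 : 0 < `|a| + 1 by rewrite ltr_wpDl.
have [|u gu] := gN (e / 2 / (`|a| + 1)); first by rewrite !divr_gt0.
have [|v hv] := hN' (e / 2); first by rewrite divr_gt0.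
exists (a *: u + v) => f; rewrite linearP.
rewrite [X in `|X - _|](_ : _ = a *: g f + h f)//.
rewrite opprD addrACA -scalerBr (le_trans (ler_normD _ _))//.
have := hv f; have : `|a *: (g f - sval f u)| <= e / 2.
  rewrite normrM (le_trans (ler_wpM2l _ (gu f)))//.
  rewrite mulrA ler_pdivrMr// mulrC ler_pM2l ?divr_gt0//.
  by rewrite lerDl.
lra.
Qed.

HB.instance Definition _ := GRing.isSubmodClosed.Build R (functional N -> R^o)
  (@approximable N) approximable_submod_closed.
HB.instance Definition _ := [isSub for @completion_val N hN].
HB.instance Definition _ := [Choice of Y by <:].
HB.instance Definition _ := [SubChoice_isSubLmodule of Y by <:].

Let vals (g : functional N -> R^o) := [set `|g f| | f in [set: functional N]].

Definition completion_norm (y : Y) : R := sup (vals y).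

Lemma completion_normP (y : Y) (M : R) :
  completion_norm y <= M <-> forall f, `|y f| <= M.
Proof.
have [f0 _] := norming_functional hN 0.
have hs : has_sup (vals y).
  split; first by exists `|y f0|; exists f0.
  have [v hv] := approximableP _ (valP y) 1 ltr01.
  exists (1 + N v) => _ [f _ <-].
  rewrite -[y f](subrK (sval f v : R)) (le_trans (ler_normD _ _))//.
  by apply: lerD; [exact: hv|exact: (svalP f)].
split=> [yM f|yM]; last by apply: ge_sup; [exact: hs.1|move=> _ [f _ <-]].
by apply: le_trans yM; apply: ub_le_sup; [exact: hs.2|exists f].
Qed.

Lemma completion_norm_ge (y : Y) f : `|y f| <= completion_norm y.
Proof. by have /completion_normP := lexx (completion_norm y). Qed.

Lemma completion_normD (x y : Y) :
  completion_norm (x + y) <= completion_norm x + completion_norm y.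
Proof.
apply/completion_normP => f.
rewrite [X in `|X|](_ : _ = x f + y f)// (le_trans (ler_normD _ _))//.
by rewrite lerD// completion_norm_ge.
Qed.

Lemma completion_normZ_le (a : R) (y : Y) :
  completion_norm (a *: y) <= `|a| * completion_norm y.
Proof.
apply/completion_normP => f; rewrite [X in `|X|](_ : _ = a *: y f)// normrM.
by rewrite ler_wpM2l// completion_norm_ge.
Qed.

Lemma completion_normZ (a : R) (y : Y) :
  completion_norm (a *: y) = `|a| * completion_norm y.
Proof.
apply/eqP; rewrite eq_le completion_normZ_le/=.
have [->|a0] := eqVneq a 0.
  rewrite normr0 mul0r.
  have [f0 _] := norming_functional hN 0.
  exact: le_trans (normr_ge0 _) (completion_norm_ge _ f0).
have := completion_normZ_le a^-1 (a *: y).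
rewrite scalerA mulVf// scale1r normfV mulrC ler_pdivlMr ?normr_gt0//.
by rewrite mulrC.
Qed.

Lemma completion_norm0_eq0 (y : Y) : completion_norm y = 0 -> y = 0.
Proof.
move=> y0; apply/val_inj/funext => f.
apply/eqP; rewrite -normr_le0 -y0; exact: completion_norm_ge.
Qed.

HB.instance Definition _ := Lmodule_isNormed.Build R Y
  completion_normD completion_normZ completion_norm0_eq0.

(** A Cauchy filter converges pointwise on the dual unit ball, and its bounds are
    uniform there, so that the pointwise limit is a uniform limit. *)
Lemma completion_complete (F : set_system Y) : ProperFilter F -> cauchy F -> cvg F.
Proof.
move=> FF /cauchyP Fc.
have F0 e : 0 < e -> exists g0 : Y, F [set g : Y | `|g0 - g| < e].
  move=> e0; have [g0] := Fc e e0; rewrite -ball_normE => Fg0.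
  by exists g0.
have ev (g h : Y) f : `|g f - h f| <= `|g - h|.
  exact: (completion_norm_ge (g - h)).
have cvf f : cvg ((fun g : Y => g f : R^o) @ F).
  apply: cauchy_cvg; apply/cauchyP => e e0; have [g0 Fg0] := F0 e e0.
  exists (g0 f : R^o); rewrite -ball_normE; apply: (@filterS _ F _ _ _ _ Fg0) => g /= gg0.
  exact: le_lt_trans (ev _ _ _) gg0.
pose G f : R^o := lim ((fun g : Y => g f : R^o) @ F).
have GF e (g0 : Y) f : F [set g : Y | `|g0 - g| < e] -> `|g0 f - G f| <= e.
  move=> Fg0; apply/ler_addgt0Pr => d d0.
  have /cvgrPdist_le /(_ d d0) Fd := cvf f.
  have [g [g1 g2]] := filter_ex (filterI Fg0 Fd).
  rewrite -(subrKA (g f : R)) (le_trans (ler_normD _ _))// lerD//; last first.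
    by rewrite distrC.
  exact: le_trans (ev _ _ _) (ltW g1).
have aG : G \in @approximable N.
  apply/approximableP => e e0; have e2 : 0 < e / 2 by rewrite divr_gt0.
  have [g0 Fg0] := F0 _ e2.
  have [v hv] := approximableP _ (valP g0) _ e2.
  exists v => f; rewrite -(subrKA (g0 f : R)) (le_trans (ler_normD _ _))//.
  have := hv f; have := GF _ _ f Fg0; rewrite distrC.
  by rewrite [val g0 f]/(g0 f); lra.
apply/cvg_ex; exists (Completion hN aG); apply/cvgrPdist_le => e e0.
have e2 : 0 < e / 2 by rewrite divr_gt0.
have [g0 Fg0] := F0 _ e2.
near=> g; apply/completion_normP => f.
rewrite [X in `|X|](_ : _ = G f - g f)//.
rewrite -(subrKA (g0 f : R)) (le_trans (ler_normD _ _))//.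
rewrite [leRHS]splitr lerD//; first by rewrite distrC; exact: GF.
apply: le_trans (ev _ _ _) _; apply: ltW.
by near: g.
Unshelve. all: by end_near. Qed.

HB.instance Definition _ := Uniform_isComplete.Build Y completion_complete.

Lemma to_completion_subproof (v : V) :
  (fun f : functional N => sval f v) \in @approximable N.
Proof.
by apply/approximableP => e e0; exists v => f; rewrite subrr normr0 ltW.
Qed.

Definition to_completion (v : V) : Y := Completion hN (to_completion_subproof v).

Lemma to_completion_linear : linear to_completion.
Proof. by move=> a u v; apply/val_inj/funext => f /=; rewrite linearP. Qed.

HB.instance Definition _ :=
  GRing.isLinear.Build R V Y *:%R to_completion to_completion_linear.

Lemma norm_to_completion (v : V) : `|to_completion v| = N v.
Proof.
apply/eqP; rewrite eq_le; apply/andP; split.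
  by apply/completion_normP => f; exact: (svalP f).
have [f /le_trans] := norming_functional hN v; apply.
exact: le_trans (ler_norm _) (completion_norm_ge (to_completion v) f).
Qed.

Lemma to_completion_dense (y : Y) (e : R) : 0 < e ->
  exists v, `|y - to_completion v| <= e.
Proof.
move=> e0; have [v hv] := approximableP _ (valP y) e e0.
by exists v; apply/completion_normP => f; exact: hv.
Qed.

End Structure.
End Completion.

(** * Finite representability of a limit of seminorms *)

Lemma independent_family {R : realType} {Y : normedModType R} (n : nat)
  (v : 'I_n -> Y) : exists (m : nat) (e : 'I_m -> Y),
  (forall c : 'I_m -> R, \sum_(i < m) c i *: e i = 0 -> forall i, c i = 0) /\
  lin_span v `<=` lin_span e.
Proof.
elim: n v => [|n IH] v; first by exists 0%N, v; split=> // c _ [].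
have [|] := pselect (forall c : 'I_n.+1 -> R,
    \sum_(i < n.+1) c i *: v i = 0 -> forall i, c i = 0).
  by move=> ind; exists n.+1, v; split.
move=> /existsNP[c] /not_implyP[c0] /existsNP[i0 /eqP ci0].
have [m [e [ind ve]]] := IH (v \o lift i0).
exists m, e; split=> // _ [a ->]; apply: ve.
exists (fun j => a (lift i0 j) - a i0 / c i0 * c (lift i0 j)).
have -> : \sum_(i < n.+1) a i *: v i =
    \sum_(i < n.+1) (a i - a i0 / c i0 * c i) *: v i.
  under [RHS]eq_bigr do rewrite scalerBl -scalerA.
  by rewrite sumrB -scaler_sumr c0 scaler0 subr0.
by rewrite (bigD1_ord i0)//= divfK// subrr scale0r add0r.
Qed.

Lemma ler_norm_coord (R : realType) m (c : 'rV[R]_m) i : `|c 0 i| <= `|c|.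
Proof.
rewrite [leRHS]/Num.norm /= mx_normrE; apply/bigmax_geP; right => /=.
by exists (0, i).
Qed.

(** All norms on a finite-dimensional space are equivalent: the norm of a
    combination attains a positive minimum on the unit sphere of coefficients. *)
Lemma independent_coercive {R : realType} {Y : normedModType R} (m : nat)
  (e : 'I_m -> Y) :
  (forall c : 'I_m -> R, \sum_(i < m) c i *: e i = 0 -> forall i, c i = 0) ->
  exists k : R, 0 < k /\ forall (c : 'I_m -> R) i,
    k * `|c i| <= `|\sum_(i < m) c i *: e i|.
Proof.
case: m e => [|m] e ind; first by exists 1; split => // c [].
pose f (c : 'rV[R]_m.+1) := `|\sum_(i < m.+1) c 0 i *: e i|.
have cf : continuous f.
  have sumf : continuous (fun c : 'rV[R]_m.+1 => \sum_(i < m.+1) c 0 i *: e i).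
    apply: (continuous_big add_continuous) => i _ c.
    by apply: cvgZr_tmp; [exact: nbhs_filter|exact: coord_continuous].
  by move=> c; exact: (cvg_norm (sumf c)).
pose A := [set c : 'rV[R]_m.+1 | `|c| = 1].
have nA (c : 'rV[R]_m.+1) : c != 0 -> A (`|c|^-1 *: c).
  by move=> c0; rewrite /A /= normrZ normfV normr_id mulVf// normr_eq0.
have A0 : A !=set0.
  exists (`|const_mx 1 : 'rV[R]_m.+1|^-1 *: const_mx 1); apply: nA.
  by apply/eqP => /matrixP /(_ 0 0); rewrite !mxE => /eqP; rewrite oner_eq0.
have cA : compact A.
  apply: bounded_closed_compact.
    by exists 1; split => // x x1 c /= ->; exact: ltW.
  apply: (@preimage_closed _ _ (fun c : 'rV[R]_m.+1 => `|c|) [set 1]).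
    by move=> c _; exact: norm_continuous.
  exact: closed_eq.
have [c0 /set_mem Ac0 fc0] := EVT_min_rV A0 cA (continuous_subspaceT cf).
have fc0_gt0 : 0 < f c0.
  rewrite lt0r normr_ge0 andbT normr_eq0; apply/eqP => /ind h.
  have c00 : c0 = 0 by apply/rowP => i; rewrite h mxE.
  by move: Ac0; rewrite /A /= c00 normr0 => /esym/eqP; rewrite oner_eq0.
exists (f c0); split => // c i; pose c' : 'rV[R]_m.+1 := \row_i c i.
have [c'0|c'0] := eqVneq c' 0.
  have := congr1 (fun M : 'rV[R]_m.+1 => M 0 i) c'0.
  by rewrite !mxE => ->; rewrite normr0 mulr0.
have := fc0 _ (mem_set (nA c' c'0)).
have -> : f (`|c'|^-1 *: c') = `|c'|^-1 * `|\sum_(i < m.+1) c i *: e i|.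
  rewrite /f; under eq_bigr do rewrite !mxE -scalerA.
  by rewrite -scaler_sumr normrZ normfV normr_id.
rewrite mulrC ler_pdivlMr ?normr_gt0// => /(le_trans _); apply.
rewrite ler_wpM2l ?normr_ge0//.
by have := ler_norm_coord c' i; rewrite mxE.
Qed.

Lemma lincomb_dist {R : realType} {X : normedModType R} (m : nat) (c d : 'I_m -> R)
    (x : 'I_m -> X) (t : R) : (forall i, `|c i - d i| <= t) ->
  `|\sum_(i < m) c i *: x i - \sum_(i < m) d i *: x i| <= t * \sum_(i < m) `|x i|.
Proof.
move=> cd; rewrite -sumrB (le_trans (ler_norm_sum _ _ _))// mulr_sumr.
by apply: ler_sum => i _; rewrite -scalerBl normrZ ler_wpM2r.
Qed.

Lemma near_all_seq (I : eqType) (T : Type) (U : set_system T) (P : I -> set T)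
  (s : seq I) : Filter U -> (forall i, i \in s -> U (P i)) ->
  U [set t | forall i, i \in s -> P i t].
Proof.
move=> FU; elim: s => [|i s IH] h.
  by apply: filterS filterT => t _ i.
have h1 : U (P i) by apply: h; rewrite mem_head.
have h2 : U [set t | forall j, j \in s -> P j t].
  by apply: IH => j js; apply: h; rewrite inE js orbT.
apply: filterS (filterI h1 h2) => t [Pi Ps] j.
by rewrite inE => /orP[/eqP ->|]; [exact: Pi|exact: Ps].
Qed.

Section FinRep.
Context {R : realType} {V : lmodType R} {X Y : normedModType R}.
Context (iota : {linear V -> Y}) (T : nat -> {linear V -> X}).
Context (U : set_system nat) {FU : ProperFilter U}.
Hypothesis dense : forall (y : Y) (e : R), 0 < e -> exists v, `|y - iota v| <= e.
Hypothesis cvgT : forall v, (fun n => `|T n v|) @ U --> `|iota v|.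

(** Pointwise convergence of the seminorms is uniform on a box of coefficients:
    it suffices to have it on a finite net, since the seminorms are equi-Lipschitz
    in the coefficients.  The error [t] is split into four quarters: passing to
    the net for the seminorm of index [j] and for the limit, the convergence on
    the net, and the approximation of [e] by vectors coming from [V]. *)
Lemma near_isometry_box (m : nat) (e : 'I_m -> Y) (t : R) : 0 < t ->
  exists (w : 'I_m -> V) (j : nat), forall c : 'I_m -> R,
    (forall i, `|c i| <= 1) ->
    `| `|T j (\sum_(i < m) c i *: w i)| - `|\sum_(i < m) c i *: e i| | <= t.
Proof.
move=> t0.
have d0 : 0 < t / 4 / m.+1%:R by rewrite !divr_gt0.
have /choice[w ew] := fun i => dense (e i) d0.
pose S := \sum_(i < m) (`|iota (w i)| + 1).
have S0 : 0 <= S by apply: sumr_ge0 => i _; rewrite addr_ge0.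
have S1 : 0 < S + 1 by rewrite ltr_wpDl.
have d1 : 0 < t / 4 / (S + 1) by rewrite !divr_gt0.
have [s hs] := box_net m 1 d1.
pose W (c : 'I_m -> R) := \sum_(i < m) c i *: w i.
have t4 : 0 < t / 4 by rewrite divr_gt0.
have U1 : U [set j | forall g, g \in s ->
    `| `|T j (W g)| - `|iota (W g)| | <= t / 4].
  apply: near_all_seq => g _.
  have /cvgrPdist_le /(_ _ t4) := @cvgT (W g).
  by apply: filterS => j; rewrite distrC.
have U2 : U [set j | forall i, i \in enum 'I_m -> `|T j (w i)| <= `|iota (w i)| + 1].
  apply: near_all_seq => i _.
  have /cvgrPdist_le /(_ _ ltr01) := @cvgT (w i).
  by apply: filterS => j; rewrite ler_norml => /andP[]; lra.
have [j [j1 j2]] := filter_ex (filterI U1 U2).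
exists w, j => c c1; have [g gs cg] := hs c c1.
have TW h : T j (W h) = \sum_(i < m) h i *: T j (w i).
  by rewrite linear_sum; apply: eq_bigr => i _; rewrite linearZ.
have iW h : iota (W h) = \sum_(i < m) h i *: iota (w i).
  by rewrite linear_sum; apply: eq_bigr => i _; rewrite linearZ.
have bound (Z : normedModType R) (x : 'I_m -> Z) :
    (forall i, `|x i| <= `|iota (w i)| + 1) ->
    `| `|\sum_(i < m) c i *: x i| - `|\sum_(i < m) g i *: x i| | <= t / 4.
  move=> xw; apply: le_trans (ler_dist_dist _ _) _.
  apply: le_trans (lincomb_dist x cg) _.
  rewrite mulrAC ler_pdivrMr// ler_pM2l//.
  by rewrite (@le_trans _ _ S) ?lerDl//; exact: ler_sum.
have B1 := bound _ (fun i => T j (w i)) (fun i => j2 i (mem_enum _ _)).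
have iw1 i : `|iota (w i)| <= `|iota (w i)| + 1 by rewrite lerDl.
have B2 := bound _ (fun i => iota (w i)) iw1.
have B3 : `| `|iota (W c)| - `|\sum_(i < m) c i *: e i| | <= t / 4.
  apply: le_trans (ler_dist_dist _ _) _.
  rewrite iW -sumrB (le_trans (ler_norm_sum _ _ _))//.
  apply: (@le_trans _ _ (\sum_(i < m) t / 4 / m.+1%:R)).
    apply: ler_sum => i _; rewrite -scalerBr normrZ distrC -[leRHS]mul1r.
    by apply: ler_pM.
  rewrite sumr_const card_ord -[leLHS]mulr_natr -[leLHS]mulrA ler_piMr ?(ltW t4)//.
  by rewrite mulrC ler_pdivrMr// mul1r ler_nat.
have B4 := j1 _ gs; rewrite -/(W c).
rewrite -TW -TW in B1; rewrite -iW -iW in B2.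
move: B1 B2 B3 B4; rewrite !ler_norml => /andP[? ?] /andP[? ?] /andP[? ?] /andP[? ?].
by apply/andP; split; lra.
Qed.

(** By homogeneity the additive error on the unit box becomes a relative error
    [eps1 / 4] once the coefficients are controlled by the norm
    ([independent_coercive]); [eps1 <= 1] ensures
    [1 + eps1 / 4 <= (1 + eps1) (1 - eps1 / 4)]. *)
Lemma near_isometry_finitely_representable : finitely_representable Y X.
Proof.
move=> n v eps eps0; have [m [e [ind ve]]] := independent_family v.
have [k [k0 ke]] := independent_coercive ind.
pose eps1 := Num.min eps 1.
have eps10 : 0 < eps1 by rewrite lt_min eps0 ltr01.
have eps1e : eps1 <= eps by rewrite ge_min lexx.
have eps11 : eps1 <= 1 by rewrite ge_min lexx orbT.
have t0 : 0 < k * (eps1 / 4) by rewrite mulr_gt0// divr_gt0.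
have [w [j wj]] := near_isometry_box e t0.
have coordP (u : Y) : exists c : 'I_m -> R,
    lin_span e u -> u = \sum_(i < m) c i *: e i.
  have [[c ->]|ue] := pselect (lin_span e u); first by exists c.
  by exists (fun=> 0).
have /choice[crd crdP] := coordP.
pose W (c : 'I_m -> R) := \sum_(i < m) c i *: w i.
have Tn c : `| `|T j (W c)| - `|\sum_(i < m) c i *: e i| | <=
    eps1 / 4 * `|\sum_(i < m) c i *: e i|.
  set g := `|\sum_(i < m) c i *: e i|.
  have [g0|g0] := eqVneq g 0.
    have c0 i : c i = 0.
      have := ke c i; rewrite -/g g0 pmulr_rle0// normr_le0 => /eqP //.
    rewrite /W big1 ?linear0 ?normr0; last by move=> i _; rewrite c0 scale0r.
    by rewrite g0 subrr normr0 mulr0.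
  have gp : 0 < g by rewrite lt0r g0 normr_ge0.
  have s0 : 0 < k / g by rewrite divr_gt0.
  have c1 i : `|k / g * c i| <= 1.
    by rewrite normrM gtr0_norm// mulrAC ler_pdivrMr// mul1r ke.
  have := wj _ c1.
  have E (Z : lmodType R) (x : 'I_m -> Z) :
      \sum_(i < m) (k / g * c i) *: x i = (k / g) *: \sum_(i < m) c i *: x i.
    by rewrite scaler_sumr; apply: eq_bigr => i _; rewrite scalerA.
  rewrite !E linearZ_LR; have [q qE] : exists q, q = k / g by exists (k / g).
  rewrite -qE in s0 *.
  rewrite !normrZ (gtr0_norm s0) -mulrBr normrM (gtr0_norm s0) -/g qE.
  by rewrite mulrAC ler_pdivrMr// -(mulrA k) ler_pM2l.
exists (fun u => T j (W (crd u))); split.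
  move=> c u u' /ve uE /ve u'E.
  have cuE : lin_span e (c *: u + u').
    exists (fun i => c * crd u i + crd u' i).
    rewrite {1}(crdP u uE) {1}(crdP u' u'E) scaler_sumr -big_split /=.
    by apply: eq_bigr => i _; rewrite scalerA -scalerDl.
  have H i : crd (c *: u + u') i = c * crd u i + crd u' i.
    apply/eqP; rewrite -subr_eq0; apply/eqP; move: i.
    apply: ind; under eq_bigr do rewrite scalerBl.
    rewrite sumrB -(crdP _ cuE); under eq_bigr do rewrite scalerDl -scalerA.
    rewrite big_split /= -scaler_sumr -(crdP _ uE) -(crdP _ u'E).
    by rewrite subrr.
  rewrite -linearP; congr (T j _); rewrite /W scaler_sumr -big_split /=.
  by apply: eq_bigr => i _; rewrite H scalerDl scalerA.
exists (1 - eps1 / 4), (1 + eps1 / 4); split.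
- lra.
- have : eps1 * eps1 <= eps1 by rewrite ler_piMr// ltW.
  have : eps1 * (1 - eps1 / 4) <= eps * (1 - eps1 / 4) by rewrite ler_wpM2r//; lra.
  lra.
move=> u /ve uE; have := Tn (crd u); rewrite -(crdP u uE).
rewrite ler_norml => /andP[? ?]; apply/andP; split; lra.
Qed.

End FinRep.

(** * Super-reflexivity makes the seeker win *)

Lemma ultrafilter_cvg (R : realType) (U : set_system nat) (u : nat -> R) (C : R) :
  UltraFilter U -> (forall n, `|u n| <= C) -> cvg (u @ U).
Proof.
move=> UU uC.
have UuC : (u @ U) `[- C, C]%classic.
  by apply: (@filterS _ U _ _ _ _ filterT) => n _ /=; rewrite in_itv /= -ler_norml; exact: uC.
have [l [_ ul]] := @segment_compact R (- C) C (u @ U) _ UuC.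
apply/cvg_ex; exists l => A Al.
have [//|UA] := in_ultra_setVsetC (u @^-1` A) UU.
by have [t [At]] := ul (~` A) A UA Al.
Qed.

Section CoefSum.
Context {R : realType} {X : normedModType R} (x : nat -> X) (n : nat).

(** Only the first [n] terms of [x] enter, as a separated sequence of length [n]
    is controlled on those indices alone. *)
Definition coef_sum (p : {poly R}) : X := \sum_(i < n) p`_i *: x i.

Lemma coef_sum_linear : linear coef_sum.
Proof.
move=> a p q; rewrite /coef_sum scaler_sumr -big_split /=; apply: eq_bigr => i _.
by rewrite coefD coefZ scalerDl scalerA.
Qed.

HB.instance Definition _ :=
  GRing.isLinear.Build R {poly R} X *:%R coef_sum coef_sum_linear.

Lemma coef_sumXn i : coef_sum 'X^i = if (i < n)%N then x i else 0.
Proof.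
rewrite /coef_sum; under eq_bigr do rewrite coefXn.
case: ltnP => [ilt|ni]; last first.
  rewrite big1// => j _; rewrite ltn_eqF ?scale0r//.
  exact: leq_trans (ltn_ord j) ni.
rewrite (bigD1 (Ordinal ilt))//= eqxx scale1r big1 ?addr0// => j ji.
by rewrite (_ : _ == i = false) ?scale0r//; apply/negbTE; rewrite -val_eqE in ji.
Qed.

Lemma coef_sum_bounded (p : {poly R}) : (forall i, (i < n)%N -> `|x i| <= 1) ->
  `|coef_sum p| <= \sum_(i < size p) `|p`_i|.
Proof.
move=> x1; rewrite -{1}[p]coefK poly_def linear_sum (le_trans (ler_norm_sum _ _ _))//.
apply: ler_sum => i _; rewrite linearZ_LR normrZ ler_piMr// /= coef_sumXn.
by case: ifP => [/x1//|_]; rewrite normr0.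
Qed.

End CoefSum.

Section Dual.
Context {R : realType} {Y : normedModType R}.

Lemma dual_le (f : Y -> R^o) (C : R) :
  linear f -> (forall y, f y <= C * `|y|) -> dual Y f.
Proof.
move=> lf fC; split=> //.
pose g : {linear Y -> R^o} := HB.pack f (GRing.isLinear.Build R Y R^o *:%R f lf).
have gC y : `|g y| <= `|C| * `|y|.
  have h z : g z <= `|C| * `|z|.
    by apply: le_trans (fC z) _; rewrite ler_wpM2r// ler_norm.
  by rewrite ler_norml h andbT lerNl -(linearN g) -(normrN y).
apply: (@bounded_linear_continuous _ _ _ g); apply/bounded_funP => r.
exists (`|C| * r) => y yr; apply: le_trans (gC y) _.
by rewrite ler_wpM2l.
Qed.

Lemma dual_norm_ge (f : Y -> R^o) (y : Y) :
  dual Y f -> `|y| <= 1 -> `|f y| <= dual_norm f.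
Proof.
move=> [lf cf] y1.
pose g : {linear Y -> R^o} := HB.pack f (GRing.isLinear.Build R Y R^o *:%R f lf).
have /bounded_funP /(_ 1)[M gM] : bounded_near g (nbhs (0 : Y)).
  by apply/linear_bounded_continuous.
apply: ub_le_sup; last by exists y.
by exists M => _ [z z1 <-]; exact: gM.
Qed.

End Dual.

(** [Y] is the completion of the polynomials for the ultralimit [N] of the
    seminorms [|T n p|], and [Phi] is the ultralimit of the sequence ['X^n] in
    the second dual of [Y].  If [Phi] is the evaluation at [y], take [q] with
    [iota q] within [1/16] of [y].  The convex combinations [p] of the ['X^n] with
    [n >= size q] satisfy [N (p - q) >= 1/4], so they stay [1/8] away from [y], and
    a functional [f] separating them from [y] contradicts
    [f y = Phi f = lim f ('X^n)]. *)
Lemma super_reflexive_wins (R : realType) (X : completeNormedModType R) :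
  super_reflexive X -> exists N, @wins R X 2^-1 N (unit_ball X).
Proof.
move=> hX; apply: contrapT => /forallNP /james_sequence /choice[x hx].
have [U [UU ooU]] := @ultraFilterLemma nat \oo _.
pose T n : {linear {poly R} -> X} := coef_sum (x n) n.
have Tb p n : `|T n p| <= \sum_(i < size p) `|p`_i|.
  by apply: coef_sum_bounded; exact: (hx n).1.
pose N p : R := lim ((fun n => `|T n p|) @ U).
have cvgN p : (fun n => `|T n p|) @ U --> N p.
  by apply: (@ultrafilter_cvg R U _ (\sum_(i < size p) `|p`_i|)) => n; rewrite normr_id.
have hN : seminorm N.
  split=> [p q|a p].
    apply: ler_cvg_to (cvgN _) (cvgD (cvgN p) (cvgN q)) _.
    by apply: nearW => n; rewrite linearD ler_normD.
  apply: cvg_lim => //.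
  under eq_cvg do rewrite linearZ_LR normrZ.
  by apply: cvgMl_tmp; exact: cvgN.
pose Y : completeNormedModType R := completion hN.
pose iota : {linear {poly R} -> Y} := to_completion hN.
have iotaN p : `|iota p| = N p by exact: norm_to_completion.
have fr : finitely_representable Y X.
  apply: (@near_isometry_finitely_representable R {poly R} X Y iota T U) => [|p].
    exact: to_completion_dense.
  by rewrite iotaN; exact: cvgN.
have iX n : `|iota 'X^n| <= 1.
  rewrite iotaN; apply: (cvgr_to_le (cvgN _)).
  apply: nearW => k; rewrite /T /= coef_sumXn.
  by case: ifP => [/((hx k).1)//|_]; rewrite normr0.
pose Phi (f : Y -> R^o) : R := lim ((fun n => f (iota 'X^n) : R) @ U).
have cvgPhi f : dual Y f -> (fun n => f (iota 'X^n) : R) @ U --> Phi f.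
  move=> df; apply: (@ultrafilter_cvg R U _ (dual_norm f)) => n.
  exact: dual_norm_ge.
have bPhi : bidual Y Phi.
  split=> [a f g df dg|].
    apply: cvg_lim => //; apply: cvgD (cvgPhi _ dg).
    by apply: cvgMl_tmp; exact: cvgPhi.
  exists 1 => f df; rewrite mul1r.
  apply: (cvgr_to_le (cvg_norm (cvgPhi _ df))).
  by apply: nearW => n; exact: dual_norm_ge.
have [y hy] := hX Y fr Phi bPhi.
have e0 : 0 < 16^-1 :> R by rewrite invr_gt0.
have [q yq] := to_completion_dense y e0.
pose m := size q.
pose P := [set p : {poly R} | [/\ forall i, (i < m)%N -> p`_i = 0,
  forall i, 0 <= p`_i & p.[1] = 1]].
have PX n : (m <= n)%N -> P 'X^n.
  move=> mn; split=> [i im|i|]; last by rewrite hornerXn expr1n.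
    by rewrite coefXn ltn_eqF// (leq_trans im).
  by rewrite coefXn.
pose C := [set y - iota p | p in P].
have cC : @convex_set R Y C.
  apply/convex_setE => _ _ t t0 t1 [p1 [a1 b1 c1] <-] [p2 [a2 b2 c2] <-].
  exists (t *: p1 + (1 - t) *: p2).
    split=> [i im|i|].
    - by rewrite coefD !coefZ a1// a2// !mulr0 addr0.
    - by rewrite coefD !coefZ addr_ge0// mulr_ge0// subr_ge0.
    - by rewrite hornerD !hornerZ c1 c2 !mulr1 addrC subrK.
  rewrite linearD !linearZ_LR !scalerBr addrACA -scalerDl addrC -opprD.
  by rewrite [t + _]addrC subrK scale1r addrC.
(* The coefficients of [p - q] of index below [m] are those of [- q], and the
   ones from [m] on are those of [p], since [m] is the size of [q]: this is the
   shape to which the separation in [X] applies for large [n]. *)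
have NP p : P p -> 4^-1 <= N (p - q).
  move=> [p0 pp p1].
  apply: (cvgr_to_ge (cvgN _)); apply: ooU.
  pose c := p - q; pose B := \sum_(i < size c) `|c`_i|.
  have cB i : `|c`_i| <= B.
    have [ic|ci] := ltnP i (size c); last by rewrite nth_default// normr0 sumr_ge0.
    by rewrite /B (bigD1 (Ordinal ic))//= lerDl sumr_ge0.
  exists (maxn m.+1 (maxn (size p) (Num.truncn B).+1)) => // n /=.
  rewrite !geq_max => /and3P[mn pn Bn].
  apply: ((hx n).2 m (fun i => c`_i) mn).
  - move=> i; apply: le_trans (cB i) _; apply: le_trans (ltW (truncnS_gt B)) _.
    by rewrite ler_nat.
  - by move=> i mi; rewrite coefB [q`_i]nth_default// subr0.
  rewrite -p1 horner_coef.
  transitivity (\sum_(0 <= i < n) p`_i).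
    rewrite (big_cat_nat (leq0n m) (ltnW mn)) /= [X in _ = X + _](_ : _ = 0).
      by rewrite add0r; apply: eq_big_nat => i /andP[mi _];
         rewrite coefB [q`_i]nth_default// subr0.
    by rewrite big_nat_cond big1// => i /andP[/andP[_ /p0]].
  rewrite (big_cat_nat (leq0n (size p)) pn) /= [X in _ + X = _](_ : _ = 0).
    rewrite addr0 big_mkord.
    by apply: eq_bigr => i _; rewrite expr1n mulr1.
  by rewrite big_nat_cond big1// => i /andP[/andP[ip _] _]; rewrite nth_default.
have arith (a b : R) : 4^-1 <= a + b -> b <= 16^-1 -> 8^-1 <= a by lra.
have CN c : C c -> 8^-1 <= `|c|.
  move=> [p Pp <-]; have := NP p Pp; rewrite -iotaN linearB.
  have : `|iota p - iota q| <= `|y - iota p| + `|y - iota q|.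
    by rewrite (distrC y (iota p)) -[iota p - iota q](subrKA y) ler_normD.
  move=> /[swap] h1 /(le_trans h1) h2.
  exact: arith h2 yq.
have [] := @separation R Y (fun y => `|y|) C 8^-1 _ cC _ CN.
- by split=> [u v|a u a0]; [exact: ler_normD|rewrite normrZ ger0_norm].
- by exists (y - iota 'X^m), 'X^m => //; exact: PX.
move=> f [lf fN fC].
have df : dual Y f.
  by apply: (@dual_le _ _ _ 1) => // z; rewrite mul1r.
have fB n : f (y - iota 'X^n) = f y - f (iota 'X^n).
  by rewrite addrC -scaleN1r lf scaleN1r addrC.
have : 8^-1 <= f y - Phi f.
  apply: (cvgr_to_ge (cvgB (cvg_cst (f y)) (cvgPhi f df))).
  apply: ooU; exists m => // n /= mn.
  rewrite -[leRHS]/(f y - f (iota 'X^n)) -fB; apply: fC.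
  by exists 'X^n => //; exact: PX.
by rewrite hy// subrr leNgt invr_gt0 ltr0n.
Qed.

(** * The rate and the theorem *)

(** The exponent is [ln 2 / ln N] for a number [N] of rounds winning at radius
    [1/2]; taking [N >= 4] makes it at most [1/2].  For [N^m <= k < N^(m+1)] the
    [m]-fold iterated strategy has radius [2^(-m)], and the constant [2] absorbs
    the gap between [k] and [N^(m+1)]. *)
Lemma wins_rate (R : realType) (X : normedModType R) (n : nat) :
  wins 2^-1 n (unit_ball X) ->
  exists w : R, [/\ 0 < w, w <= 2^-1 & forall k : nat, (0 < k)%N ->
    wins (2 * k%:R `^ (- w)) k (unit_ball X)].
Proof.
move=> win0; pose N := maxn n 4.
have win : wins 2^-1 N (unit_ball X) by apply: wins_le win0; exact: leq_maxl.
have N4 : (4 <= N)%N by exact: leq_maxr.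
have N0 : 0 < N%:R :> R by rewrite ltr0n (leq_trans _ N4).
have l2 : 0 < ln 2 :> R by rewrite ln_gt0// ltr1n.
have lN : 2 * ln 2 <= ln N%:R :> R.
  have -> : 2 * ln 2 = ln 4%:R :> R.
    by rewrite (natrM _ 2 2) lnM ?posrE// mulr_natl mulr2n.
  by rewrite ler_ln ?posrE // ler_nat.
have lN0 : 0 < ln N%:R :> R by lra.
exists (ln 2 / ln N%:R); set w := _ / _.
have w0 : 0 < w by rewrite divr_gt0.
split=> // [|k k0]; first by rewrite ler_pdivrMr//; lra.
have Nw : N%:R `^ w = 2 :> R.
  by rewrite /powR gt_eqF// /w divfK ?gt_eqF// lnK// posrE.
have /andP[Nk kN] := trunc_log_bounds (leq_trans (isT : (1 < 4)%N) N4) k0.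
set m := trunc_log N k in Nk kN.
apply: wins_radius (wins_le Nk (wins_expn m _ win)); last by rewrite invr_gt0.
have kw : k%:R `^ w <= 2 ^+ m.+1 :> R.
  have -> : 2 ^+ m.+1 = (N ^ m.+1)%N%:R `^ w :> R.
    rewrite natrX -(powR_mulrn _ (ltW N0)) -powRrM mulrC powRrM Nw.
    by rewrite powR_mulrn.
  by apply: ge0_ler_powR; rewrite ?nnegrE ?ler0n ?ler_nat ?(ltW w0) ?(ltnW kN).
rewrite powRN exprVn -[leRHS]invrK lef_pV2 ?posrE ?exprn_gt0//; last first.
  by rewrite invr_gt0 mulr_gt0// invr_gt0 powR_gt0// ltr0n.
rewrite invfM invrK mulrC ler_pdivrMr// mulrC -exprS.
exact: kw.
Qed.

Theorem theorem1p3 (R : realType) (X : completeNormedModType R)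
    (hX : super_reflexive X) :
  exists C w : R, [/\ 0 < C, 0 < w, w <= 2^-1 &
    forall (k : nat) (alpha : R) (I : 'I_k -> finType)
           (F : forall i : 'I_k, I i -> set X),
      (0 < k)%N ->
      0 < alpha -> alpha <= 1 ->
      (forall i : 'I_k, (0 < #|I i|)%N) ->
      (forall (i : 'I_k) (j : I i), @convex_set R X (F i j)) ->
      alpha * (\prod_(i < k) #|I i|)%N%:R <=
        (num_meeting
          (fun t : rainbow_tuple I => \bigcap_(i in [set: 'I_k]) F i (t i))
          (unit_ball X))%:R ->
      let beta := 1 - (1 - alpha) `^ (k%:R^-1) in
      let r := C * k%:R `^ (- w) in
      exists (x : X) (i : 'I_k),
        beta * #|I i|%:R <= (num_meeting (F i) (scaled_ball r x))%:R].
Proof.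
have [N win] := super_reflexive_wins hX.
have [w [w0 w2 hw]] := wins_rate win.
exists 2, w; split=> // k alpha I F k0 a0 a1 I0 cF meet beta r.
apply: wins_fractional_helly a0 a1 I0 cF meet => //.
  by rewrite /r mulr_gt0// powR_gt0// ltr0n.
exact: hw.
Qed.
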